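(* Let $X$ be a real Banach space with topological dual $Y=X^\prime$, and let $C\subseteq X$ be a subset. Then the following are equivalent: (i) $C$ is a norm-closed cone; (ii) $C$ is represented by a family $\mathscr{K}$ of nonempty $\sigma(Y,X)$-compact sets; (iii) $C$ is represented by a family $\mathscr{K}$ of nonempty $\sigma(Y,X)$-compact convex sets.
   Context: Write $\langle x,y\rangle:=y(x)$ for $x\in X$, $y\in Y=X^\prime$; $\sigma(Y,X)$ is the weak$^\star$ topology on $Y$. A nonempty subset $C\subseteq X$ is a cone if $\lambda C\subseteq C$ for all real $\lambda>0$. Given a nonempty family $\mathscr{K}\subseteq\mathcal{P}(Y)$ of nonempty sets, $C$ is represented by $\mathscr{K}$ if $C=C_{\mathscr{K}}$, where $$C_{\mathscr{K}}:=\{x\in X:\ \forall K\in\mathscr{K},\ \exists y\in K,\ \langle x,y\rangle\ge 0\}.$$ *)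

(* Defs.v *)
From HB Require Import structures.
From mathcomp Require Import all_boot all_order all_algebra.
From mathcomp Require Import all_classical all_reals all_analysis.

Set Implicit Arguments.
Unset Strict Implicit.
Unset Printing Implicit Defensive.

Import Order.TTheory GRing.Theory Num.Theory numFieldNormedType.Exports.

Local Open Scope classical_set_scope.
Local Open Scope ring_scope.

Section Dual.
Context {R : realType} (X : normedModType R).

Definition dual_pred : {pred X -> R^o} :=
  fun f => `[< linear f /\ continuous f >].

Record dual := Dual { dual_val :> X -> R^o; dualP : dual_val \in dual_pred }.

HB.instance Definition _ := [isSub for dual_val].
HB.instance Definition _ := [Choice of dual by <:].

Lemma dual_pred_submod_closed : submod_closed dual_pred.
Proof.
split.
  apply/asboolP; split; last by move=> x; exact: cvg_cst.
  by move=> a u v; rewrite scaler0 addr0.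
move=> a f g /asboolP[lf cf] /asboolP[lg cg]; apply/asboolP; split.
  move=> b u v; rewrite !fctE lf lg /=.
  by rewrite !scalerDr !scalerA [b * a]mulrC addrACA.
by move=> x; apply: cvgD; [apply: cvgZr; exact: cf|exact: cg].
Qed.

HB.instance Definition _ :=
  GRing.isSubmodClosed.Build R (X -> R^o) dual_pred dual_pred_submod_closed.
HB.instance Definition _ := [SubChoice_isSubLmodule of dual by <:].

Definition pairing (x : X) (y : dual) : R := y x.

(* sigma(dual, X): the topology induced on the dual by that of pointwise
   convergence on all functions X -> R, i.e., the coarsest topology for which
   every evaluation y |-> pairing x y is continuous. *)
Definition weak_star : Type :=
  initial_topology (fun y : dual => (dual_val y : {ptws X -> R^o})).

HB.instance Definition _ := Topological.on weak_star.

End Dual.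

Section Cones.
Context {R : realType} {X : normedModType R}.

Definition is_cone (C : set X) :=
  C !=set0 /\ forall l : R, 0 < l -> [set l *: x | x in C] `<=` C.

Definition represented_set (KK : set (set (dual X))) : set X :=
  [set x | forall K, KK K -> exists2 y, K y & 0 <= pairing x y].

Definition represented_by (C : set X) (KK : set (set (dual X))) :=
  [/\ KK !=set0, (forall K, KK K -> K !=set0) & C = represented_set KK].

Definition weak_star_compact (K : set (dual X)) :=
  compact (K : set (weak_star X)).

End Cones.

(* Main.v *)
Require Import Defs.
From HB Require Import structures.
From mathcomp Require Import all_boot all_order all_algebra.
From mathcomp Require Import all_classical all_reals all_analysis.
From mathcomp Require Import lra.
Import Order.TTheory GRing.Theory Num.Theory numFieldNormedType.Exports.
Local Open Scope classical_set_scope.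
Local Open Scope ring_scope.

(** A closed cone [C] is represented by weak-star compact convex sets because
    points outside [C] can be separated from the points of [C] one ray at a
    time, with functionals taken from one fixed compact set.  Let [x0] be
    outside [C], at distance at least [r > 0] from [C].  For [x] in [C] the
    whole ray [t *: x], [0 <= t], stays at distance at least [r] from [x0], so
    Hahn-Banach yields a functional [y] of norm at most 1 with
    [0 <= pairing x y] and [pairing x0 y <= - r] ([separate_point_ray]).  The
    slice of the dual unit ball cut out by the last inequality is convex, is
    weak-star compact by Banach-Alaoglu ([weak_star_compact_dual_ball]), and
    depends on [x0] and [r] only: every [x] in [C] finds in it some [y] with
    [0 <= pairing x y], and [x0] finds none.  Hence [C] is represented by the
    family of all weak-star compact convex sets [K] that meet
    [[set y | 0 <= pairing x y]] for every [x] in [C]; taking all such [K]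
    makes the family nonempty even if [C] is the whole space.

    Conversely, a represented set is an intersection of sets of the form
    [[set x | exists2 y, K y & 0 <= pairing x y]], each stable under positive
    scaling.  Such a set is closed ([closed_exists_pairing_ge0]): if it misses
    [x0], then [pairing x0] has a negative maximum on the compact set [K], and
    since [K] is norm bounded, by the uniform boundedness principle on the
    Banach space [X], this persists on a ball around [x0].  This one argument
    covers both kinds of families.

    Hahn-Banach is obtained from the fact that a minimal sublinear functional
    is linear.  The operation [tilt], which lowers a sublinear functional
    towards a prescribed slope in one direction, serves three times: it shows
    this linearity, and it imposes the two sign conditions of the
    separation. *)

(** * Sublinear functionals and Hahn-Banach *)

Section Sublinear.
Context {R : realType} {V : lmodType R}.
Implicit Types (p q : V -> R) (G : set (V -> R)).

Definition sublinear q :=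
  (forall x y, q (x + y) <= q x + q y) /\
  (forall l x, 0 < l -> q (l *: x) <= l * q x).

Lemma sublinear_ge0 q : sublinear q -> 0 <= q 0.
Proof. by move=> [qD _]; have := qD 0 0; rewrite addr0 lerDl. Qed.

Lemma sublinear0 q : sublinear q -> q 0 = 0.
Proof.
move=> sq; apply/eqP; rewrite eq_le sublinear_ge0// andbT.
have := sq.2 2^-1 0; rewrite scaler0 => /(_ ltac:(lra)); lra.
Qed.

Lemma sublinear_geN q x : sublinear q -> - q (- x) <= q x.
Proof.
move=> sq; have := sq.1 x (- x); rewrite subrr => h.
by have := sublinear_ge0 _ sq; lra.
Qed.

Definition pointwise_inf G x : R := inf [set g x | g in G].

Section PointwiseInf.
Variable G : set (V -> R).
Hypothesis G_lb : forall x, exists b, forall g, G g -> b <= g x.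

Lemma pointwise_inf_le g x : G g -> pointwise_inf G x <= g x.
Proof.
move=> Gg; have [b bG] := G_lb x; apply: ge_inf; last by exists g.
by exists b => _ [h Gh <-]; exact: bG.
Qed.

Lemma le_pointwise_inf b x : G !=set0 ->
  (forall g, G g -> b <= g x) -> b <= pointwise_inf G x.
Proof.
move=> [g Gg] bG; apply: lb_le_inf; first by exists (g x); exists g.
by move=> _ [h Gh <-]; exact: bG.
Qed.

(** The two closure conditions cover both chains of sublinear functionals and
    the family of shifts of a single one, whose members are not themselves
    sublinear. *)
Lemma sublinear_pointwise_inf : G !=set0 ->
  (forall g h x y, G g -> G h -> exists2 k, G k & k (x + y) <= g x + h y) ->
  (forall g l x, G g -> 0 < l -> exists2 k, G k & k (l *: x) <= l * g x) ->
  sublinear (pointwise_inf G).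
Proof.
move=> G0 GD GZ; split=> [x y|l x l0].
  rewrite -lerBlDr; apply: le_pointwise_inf => // g Gg.
  rewrite lerBlDr -lerBlDl; apply: le_pointwise_inf => // h Gh.
  have [k Gk kgh] := GD g h x y Gg Gh.
  by rewrite lerBlDl (le_trans _ kgh)// pointwise_inf_le.
rewrite -ler_pdivrMl//; apply: le_pointwise_inf => // g Gg.
have [k Gk kg] := GZ g l x Gg l0.
by rewrite ler_pdivrMl// (le_trans _ kg)// pointwise_inf_le.
Qed.

End PointwiseInf.

(** When [c <= q a], this is the greatest sublinear functional [q'] below [q]
    such that [q' (- a) <= - c]; a linear functional below it therefore takes
    a value at least [c] at [a].  For [q] a norm and [c = 0], it is the
    distance to the ray opposite to [a]. *)
Definition tilt q (a : V) (c : R) : V -> R :=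
  pointwise_inf
    [set g | exists2 t, 0 <= t & g = fun x => q (x + t *: a) - t * c].

Section Tilt.
Variables (q : V -> R) (a : V) (c : R).
Hypotheses (q_sub : sublinear q) (c_le : c <= q a).

Let tilt_lb x : exists b, forall g,
  (exists2 t, 0 <= t & g = fun x => q (x + t *: a) - t * c) -> b <= g x.
Proof.
exists (- q (- x)) => _ [t t0 ->].
have [->|tN0] := eqVneq t 0.
  by rewrite scale0r addr0 mul0r subr0; exact: sublinear_geN.
have {}t0 : 0 < t by rewrite lt_def tN0.
have := q_sub.1 (x + t *: a) (- x).
rewrite [x + _]addrC addrK => h.
have := q_sub.2 t^-1 (t *: a); rewrite invr_gt0 scalerA mulVf// scale1r.
move=> /(_ t0); rewrite ler_pdivlMl// => h'.
have : t * c <= t * q a by rewrite ler_pM2l.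
lra.
Qed.

Lemma tilt_le_shift t x : 0 <= t -> tilt q a c x <= q (x + t *: a) - t * c.
Proof.
move=> t0; apply: (pointwise_inf_le _ tilt_lb (fun x => q (x + t *: a) - t * c)).
by exists t.
Qed.

Lemma tilt_le x : tilt q a c x <= q x.
Proof.
by have := tilt_le_shift 0 x (lexx 0); rewrite scale0r addr0 mul0r subr0.
Qed.

Lemma tiltN_le : tilt q a c (- a) <= - c.
Proof.
have := tilt_le_shift 1 (- a) ler01.
by rewrite scale1r mul1r addNr sublinear0// sub0r.
Qed.

Lemma le_tilt b x : (forall t, 0 <= t -> b <= q (x + t *: a) - t * c) ->
  b <= tilt q a c x.
Proof.
move=> bq; apply: le_pointwise_inf.
  by exists (fun x => q (x + 0 *: a) - 0 * c); exists 0.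
by move=> _ [t t0 ->]; exact: bq.
Qed.

Lemma sublinear_tilt : sublinear (tilt q a c).
Proof.
apply: sublinear_pointwise_inf => //.
- by exists (fun x => q (x + 0 *: a) - 0 * c); exists 0.
- move=> _ _ x y [s s0 ->] [t t0 ->].
  exists (fun x => q (x + (s + t) *: a) - (s + t) * c).
    by exists (s + t) => //; exact: addr_ge0.
  have := q_sub.1 (x + s *: a) (y + t *: a).
  by rewrite addrACA -scalerDl; lra.
- move=> _ l x [t t0 ->] l0.
  exists (fun x => q (x + (l * t) *: a) - (l * t) * c).
    by exists (l * t) => //; rewrite mulr_ge0// ltW.
  have := q_sub.2 l (x + t *: a) l0.
  by rewrite scalerDr scalerA; lra.
Qed.

End Tilt.

(** Zorn's lemma applies because the values at [x] of sublinear functionals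
    below [p] are bounded below by [- p (- x)], so that chains have infima. *)
Lemma exists_minimal_sublinear p : sublinear p -> exists q,
  [/\ sublinear q, forall x, q x <= p x &
      forall q', sublinear q' -> (forall x, q' x <= q x) -> q' = q].
Proof.
move=> p_sub.
pose below_p (q : V -> R) := sublinear q /\ forall x, q x <= p x.
pose T := {q | below_p q}.
pose ge (q q' : T) := `[< forall x, sval q' x <= sval q x >].
pose p0 : T := exist below_p p (conj p_sub (fun x => lexx (p x))).
have [| |A totA|q qmin] := @ZL_preorder T p0 ge.
- by move=> q; apply/asboolP.
- move=> r s t /asboolP rs /asboolP st; apply/asboolP => x.
  exact: le_trans (st x) (rs x).
- have [[q0 Aq0]|A0] := pselect (A !=set0); last first.
    by exists p0 => s As; exfalso; apply: A0; exists s.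
  pose G : set (V -> R) := [set sval q | q in A].
  have GN0 : G !=set0 by exists (sval q0); exists q0.
  have G_lb x : exists b, forall g, G g -> b <= g x.
    exists (- p (- x)) => _ [q Aq <-].
    apply: le_trans (sublinear_geN _ x (svalP q).1).
    by rewrite lerN2; exact: (svalP q).2.
  have Gsub : sublinear (pointwise_inf G).
    apply: sublinear_pointwise_inf => //.
      move=> _ _ x y [g Ag <-] [h Ah <-].
      have [/asboolP gh|/asboolP hg] := totA g h Ag Ah.
        exists (sval h); first by exists h.
        by apply: le_trans ((svalP h).1.1 x y) _; rewrite lerD2r.
      exists (sval g); first by exists g.
      by apply: le_trans ((svalP g).1.1 x y) _; rewrite lerD2l.
    move=> _ l x [g Ag <-] l0; exists (sval g); first by exists g.
    exact: (svalP g).1.2.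
  have Gp x : pointwise_inf G x <= p x.
    apply: le_trans ((svalP q0).2 x).
    by apply: pointwise_inf_le => //; exists q0.
  exists (exist below_p _ (conj Gsub Gp)) => s As; apply/asboolP => x /=.
  by apply: pointwise_inf_le => //; exists s.
exists (sval q); split; [exact: (svalP q).1|exact: (svalP q).2|].
move=> q' q'_sub q'q.
have q'p x : q' x <= p x by exact: le_trans (q'q x) ((svalP q).2 x).
have /asboolP qq' : ge (exist below_p q' (conj q'_sub q'p)) q.
  by apply: qmin; apply/asboolP => x; exact: q'q.
by apply/funext => x; apply/eqP; rewrite eq_le q'q/= qq'.
Qed.

(** A minimal [q] equals each of its tilts [tilt q x (q x)], which forces
    [q (- x) <= - q x]; sublinearity then turns into linearity. *)
Lemma exists_linear_le_sublinear p : sublinear p ->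
  exists2 f : V -> R^o, linear f & forall x, f x <= p x.
Proof.
move=> /exists_minimal_sublinear[q [q_sub qp qmin]]; exists q => //.
have qN x : q (- x) = - q x.
  apply/eqP; rewrite eq_le; apply/andP; split.
    rewrite -[X in X (- x) <= _](qmin (tilt q x (q x))).
    - exact: tiltN_le.
    - exact: sublinear_tilt.
    - exact: tilt_le.
  by have := sublinear_geN _ x q_sub; lra.
have qD x y : q (x + y) = q x + q y.
  apply/eqP; rewrite eq_le q_sub.1/=.
  have := q_sub.1 (- x) (- y).
  by rewrite -opprD !qN; lra.
have qZ l x : 0 < l -> q (l *: x) = l * q x.
  move=> l0; apply/eqP; rewrite eq_le q_sub.2//=.
  have := q_sub.2 l (- x) l0.
  by rewrite scalerN !qN; lra.
move=> l x y; rewrite qD; congr (_ + _).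
have [l0|l0|->] := ltgtP l 0; [|exact: qZ|by rewrite !scale0r sublinear0].
rewrite -[l]opprK scaleNr qN qZ ?oppr_gt0// [RHS]mulNr.
by [].
Qed.

End Sublinear.

(** * Separation of a point from a ray *)

Section Separation.
Context {R : realType} {X : normedModType R}.
Implicit Types (x : X) (y : dual X).

Definition dual_ball (M : R) : set (dual X) :=
  [set y | forall x, `|pairing x y| <= M * `|x| ].

Lemma dual_linear y : linear y.
Proof. by have /asboolP[] := dualP y. Qed.

HB.instance Definition _ y :=
  GRing.isLinear.Build R X R^o *:%R (dual_val y) (dual_linear y).

Lemma dual_continuous y : continuous y.
Proof. by have /asboolP[] := dualP y. Qed.

Lemma mem_dual (f : X -> R^o) M : linear f ->
  (forall x, `|f x| <= M * `|x|) -> f \in @dual_pred R X.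
Proof.
move=> lf fM; apply/asboolP; split => //.
pose fL : {linear X -> R^o} := HB.pack f (GRing.isLinear.Build _ _ _ _ _ lf).
apply: (@bounded_linear_continuous _ _ _ fL).
apply/linear_boundedP; exists M; split; first exact: num_real.
by move=> r Mr x; apply: le_trans (fM x) _; rewrite ler_wpM2r// ltW.
Qed.

(** Tilting the norm along [x] gives the distance to the ray spanned by [- x],
    which is at least [r] at [- x0]; a second tilt, along [- x0] with slope
    [r], is therefore legitimate.  Any linear functional below the result
    satisfies the three conclusions. *)
Lemma separate_point_ray x x0 (r : R) :
  (forall t, 0 <= t -> r <= `|x0 - t *: x|) ->
  exists y, [/\ dual_ball 1 y, 0 <= pairing x y & pairing x0 y <= - r].
Proof.
move=> rx.
pose nm : X -> R := fun z => `|z|.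
have nm_sub : sublinear nm.
  split=> [u v|l u l0]; first exact: ler_normD.
  by rewrite /nm normrZ gtr0_norm.
have nm_ge0 : 0 <= nm x by exact: normr_ge0.
pose q := tilt nm x 0.
have q_sub : sublinear q by exact: sublinear_tilt.
have rq : r <= q (- x0).
  apply: le_tilt => t t0; rewrite mulr0 subr0 /nm -normrN opprD opprK.
  exact: rx.
have [f lf fq] := exists_linear_le_sublinear _ (sublinear_tilt _ _ _ q_sub rq).
have {}fq z : f z <= tilt q (- x0) r z := fq z.
have fN z : f (- z) = - f z.
  have := linearN (HB.pack f (GRing.isLinear.Build _ _ _ _ _ lf) : {linear _ -> _}).
  exact.
have fx z : f z <= q z := le_trans (fq z) (tilt_le _ _ _ q_sub rq z).
have fnm z : `|f z| <= 1 * `|z|.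
  rewrite mul1r ler_norml; apply/andP; split.
    rewrite lerNl -fN -normrN; apply: le_trans (fx _) _.
    exact: tilt_le.
  by apply: le_trans (fx _) _; exact: tilt_le.
exists (Dual (mem_dual f 1 lf fnm)); split => //; rewrite /pairing/=.
  rewrite -oppr_le0 -fN; apply: le_trans (fx _) _.
  by have := tiltN_le nm x 0 nm_sub nm_ge0; rewrite oppr0.
apply: le_trans (fq _) _.
by have := tiltN_le q (- x0) r q_sub rq; rewrite opprK.
Qed.

End Separation.

(** * Weak-star compactness of dual balls *)

Lemma compact_initial (S : choiceType) (T : topologicalType) (f : S -> T)
    (K : set S) :
  compact (f @` K) -> compact (K : set (initial_topology f)).
Proof.
move=> cK F FF FK.
have [|_ [[y Ky <-] cluy]] := cK (f @ F) (fmap_proper_filter f FF).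
  by apply: (@filterS S F _ K) FK => y Ky; exists y.
exists y; split => // A B FA [_ [[U Uo <-] Uy] UB].
have [|_ [[z Az <-] Uz]] := cluy (f @` A) U _ (open_nbhs_nbhs (conj Uo Uy)).
  by apply: (@filterS S F _ A) FA => z Az; exists z.
by exists z; split => //; exact: UB.
Qed.

Section WeakStar.
Context {R : realType} {X : normedModType R}.

Lemma pairing_continuous (x : X) : continuous (pairing x : weak_star X -> R).
Proof.
move=> y; rewrite /pairing.
apply: (@continuous_comp (weak_star X) {ptws X -> R^o} R
  (fun y => dual_val y : {ptws X -> R^o}) (fun g => g x)).
  exact: initial_continuous.
exact: (@proj_continuous X (fun=> R^o)).
Qed.

Lemma closed_linear : closed [set g : {ptws X -> R^o} | linear g].
Proof.
rewrite (_ : mkset _ = \bigcap_(i in [set: R * X * X])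
    (fun g : {ptws X -> R^o} =>
       g (i.1.1 *: i.1.2 + i.2) - (i.1.1 *: g i.1.2 + g i.2)) @^-1` [set 0]).
  apply: closed_bigI => -[[l x] y] _ /=.
  apply: preimage_closed; last exact: closed_eq.
  move=> g /= _.
  have ev z : (fun h : {ptws X -> R^o} => h z) @ nbhs g --> (g z : R^o).
    exact: (@proj_continuous X (fun=> R^o)).
  exact: (cvgB (ev _) (cvgD (cvgZl_tmp (k := l) (ev x)) (ev y))).
apply/seteqP; split => [g lg [[l x] y] _|g lg l x y] /=.
  by rewrite lg subrr.
by apply/eqP; rewrite -subr_eq0; apply/eqP; exact: (lg (l, x, y)).
Qed.

(** Banach-Alaoglu: seen among all functions, the ball is a closed subset of a
    product of segments, because a pointwise limit of linear functionals
    bounded by [M] is linear and bounded by [M], hence continuous. *)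
Lemma weak_star_compact_dual_ball M :
  weak_star_compact (dual_ball M : set (dual X)).
Proof.
apply: compact_initial.
rewrite (_ : image _ _ =
  [set g : {ptws X -> R^o} |
    forall x, `[- (M * `|x|), M * `|x|]%classic (g x)] `&`
  [set g | linear g]).
  apply: compact_closedI closed_linear.
  apply: (@tychonoff X (fun=> R^o)
    (fun x => `[- (M * `|x|), M * `|x|]%classic)) => x.
  exact: segment_compact.
apply/seteqP; split => [_ [y yM <-]|g [gM lg]].
  split; last exact: dual_linear.
  by move=> x /=; rewrite in_itv/= -ler_norml; exact: yM.
have {}gM x : `|g x| <= M * `|x|.
  by have := gM x; rewrite /= in_itv/= -ler_norml.
by exists (Dual (mem_dual g M lg gM)).
Qed.

End WeakStar.

(** * Represented sets are closed cones *)

Section Bounded.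
Context {R : realType} {X : completeNormedModType R}.

(** A weak-star compact set is pointwise bounded, as each evaluation is
    weak-star continuous; completeness of [X] then gives a uniform bound. *)
Lemma weak_star_compact_bounded (K : set (dual X)) : weak_star_compact K ->
  exists2 M, 0 < M & K `<=` dual_ball M.
Proof.
move=> cK.
have [[y0 Ky0]|K0] := pselect (K !=set0); last first.
  by exists 1 => // y Ky; exfalso; apply: K0; exists y.
have [|x|M MK] := @Banach_Steinhauss R X R^o [set dual_val y | y in K] _ _ 1.
- move=> _ [y Ky <-]; split; last exact: dual_linear.
  apply/(bounded_funP (dual_val y))/linear_bounded_continuous.
  exact: dual_continuous.
- have [||y1 _ maxy] := @compact_EVT_max (weak_star X) R
      (fun y => `|pairing x y|) K _ cK.
  + by exists y0.
  + apply: continuous_subspaceT => y.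
    apply: (@continuous_comp (weak_star X) R^o R (pairing x) Num.norm).
      exact: pairing_continuous.
    exact: norm_continuous.
  + exists `|pairing x y1| => _ [y Ky <-].
    by apply: maxy; exact/mem_set.
have M0 : 0 <= M.
  have := MK _ (ex_intro2 _ _ _ Ky0 erefl) 0.
  by rewrite normr0 => /(_ ler01); exact: le_trans.
(* M can be 0, when K contains only the zero functional *)
exists (M + 1); first by lra.
move=> y Ky x; have [->|x0] := eqVneq x 0.
  by rewrite /pairing linear0 normr0 normr0 mulr0.
have nx0 : 0 < `|x| by rewrite normr_gt0.
have := MK _ (ex_intro2 _ _ _ Ky erefl) (`|x|^-1 *: x).
rewrite normrZ ger0_norm ?invr_ge0// mulVf ?gt_eqF// => /(_ (lexx _)).
rewrite linearZ/= normrZ ger0_norm ?invr_ge0//.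
rewrite ler_pdivrMl// mulrC => h; apply: le_trans h _.
by rewrite ler_wpM2r//; lra.
Qed.

(** If [pairing x0] is negative on [K], its maximum [- e] there is negative,
    and a point [x] within [e / M] of [x0], where [M] bounds the norms on [K],
    still pairs negatively with every [y] in [K]. *)
Lemma closed_exists_pairing_ge0 (K : set (dual X)) : weak_star_compact K ->
  closed [set x : X | exists2 y, K y & 0 <= pairing x y].
Proof.
move=> cK; have [M M0 KM] := weak_star_compact_bounded _ cK.
have [[y0 Ky0]|K0] := pselect (K !=set0); last first.
  rewrite (_ : mkset _ = set0); first exact: closed0.
  by rewrite -subset0 => x [y Ky _]; apply: K0; exists y.
rewrite -[mkset _]setCK; apply: open_closedC; rewrite openE => x0 /= Kx0.
have [||y1 /set_mem Ky1 maxy1] := @compact_EVT_max (weak_star X) R (pairing x0) K _ cK.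
- by exists y0.
- by apply: continuous_subspaceT; exact: pairing_continuous.
have neg : pairing x0 y1 < 0.
  by rewrite ltNge; apply/negP => h; apply: Kx0; exists y1.
apply/nbhs_normP; exists (- pairing x0 y1 / M) => /=.
  by rewrite divr_gt0// oppr_gt0.
move=> x /=; rewrite ltr_pdivlMr// => xx0 [y Ky]; apply/negP; rewrite -ltNge.
have -> : pairing x y = pairing x0 y - pairing (x0 - x) y.
  by rewrite /pairing -linearB opprB addrC subrK.
have := KM y Ky (x0 - x); rewrite ler_norml => /andP[h _].
have := maxy1 y (mem_set Ky).
lra.
Qed.

Lemma closed_cone_represented_set (KK : set (set (dual X))) :
  (forall K, KK K -> K !=set0 /\ weak_star_compact K) ->
  closed (represented_set KK) /\ is_cone (represented_set KK).
Proof.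
move=> KKc; split.
  rewrite (_ : represented_set KK = \bigcap_(K in KK)
     [set x | exists2 y, K y & 0 <= pairing x y]) //.
  by apply: closed_bigI => K /KKc[_]; exact: closed_exists_pairing_ge0.
split.
  exists 0 => K /KKc[[y Ky] _]; exists y => //.
  by rewrite /pairing linear0.
move=> l l0 _ [x xK <-] K /xK[y Ky yx]; exists y => //.
by rewrite /pairing linearZ; apply: mulr_ge0 => //; exact: ltW.
Qed.

End Bounded.

(** * Closed cones are represented *)

Section Representation.
Context {R : realType} {X : normedModType R}.

Definition separating_slice (x0 : X) (r : R) : set (dual X) :=
  dual_ball 1 `&` [set y | pairing x0 y <= - r].

Lemma weak_star_compact_separating_slice x0 r :
  weak_star_compact (separating_slice x0 r).
Proof.
apply: (@compact_closedI (weak_star X)); first exact: weak_star_compact_dual_ball.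
apply: (@preimage_closed (weak_star X) R (pairing x0) [set z | z <= - r]).
  by move=> y _; exact: pairing_continuous.
exact: closed_le.
Qed.

Lemma convex_set_separating_slice x0 r :
  convex_set (separating_slice x0 r : set (convex_lmodType (dual X))).
Proof.
move=> y1 y2 k /set_mem[y1b y1r] /set_mem[y2b y2r]; apply/mem_set.
have k0 : 0 <= k%:num by exact: ge0.
have k1 : 0 <= 1 - k%:num by rewrite subr_ge0 le1.
have pc x : pairing x (conv k y1 y2) =
    k%:num * pairing x y1 + (1 - k%:num) * pairing x y2.
  by [].
split=> [x|]; last first.
  suff: pairing x0 (conv k y1 y2) <= - r by [].
  rewrite pc.
  have := ler_wpM2l k0 y1r; have := ler_wpM2l k1 y2r.
  by lra.
rewrite pc.
apply: le_trans (ler_normD _ _) _; rewrite !normrM (ger0_norm k0) (ger0_norm k1).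
have := ler_wpM2l k0 (y1b x); have := ler_wpM2l k1 (y2b x).
by lra.
Qed.

(** The radius [r] is chosen before [x]: this uniformity lets a single
    compact set serve all of [C] at once. *)
Lemma closed_cone_separating_slice (C : set X) x0 : closed C -> is_cone C ->
  ~ C x0 -> exists2 r, 0 < r &
    forall x, C x -> exists2 y, separating_slice x0 r y & 0 <= pairing x y.
Proof.
move=> cC [[c Cc] coneC] nCx0.
have [r /= r0 rC] : exists2 r : R, 0 < r & forall x, C x -> r <= `|x0 - x|.
  have /nbhs_normP[r /= r0 rC] : nbhs x0 (~` C).
    by apply: open_nbhs_nbhs; split => //; exact: closed_openC.
  by exists r => // x Cx; rewrite leNgt; apply/negP => /rC.
exists r => // x Cx.
have [t t0|y [yb yx yx0]] := separate_point_ray x x0 r; last by exists y.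
have [->|tN0] := eqVneq t 0; last first.
  by apply: rC; apply: (coneC t); [rewrite lt_def tN0|exists x].
(* the vertex of the ray is a limit of points s *: x of C as s tends to 0 *)
rewrite scale0r subr0; apply/ler_addgt0Pr => e e0.
pose s := e / (`|x| + 1).
have nx : 0 < `|x| + 1 by rewrite ltr_wpDl.
have s0 : 0 < s by rewrite divr_gt0.
have Csx : C (s *: x) by apply: (coneC s) => //; exists x.
apply: le_trans (rC _ Csx) _; apply: le_trans (ler_normB _ _) _.
rewrite lerD2l normrZ gtr0_norm// /s -mulrA ler_piMr ?(ltW e0)//.
by rewrite mulrC ler_pdivrMr// mul1r lerDl.
Qed.

Lemma closed_cone_represented (C : set X) : closed C -> is_cone C ->
  exists2 KK : set (set (dual X)), represented_by C KK &
    forall K, KK K ->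
      weak_star_compact K /\ convex_set (K : set (convex_lmodType (dual X))).
Proof.
move=> cC coneC; have [[c Cc] _] := coneC.
exists [set K | [/\ weak_star_compact K,
    convex_set (K : set (convex_lmodType (dual X))) &
    forall x, C x -> exists2 y, K y & 0 <= pairing x y]]; last first.
  by move=> K [].
split.
(* the slice at the point 0 with r = 0 is the whole dual unit ball *)
- exists (separating_slice 0 0); split.
  + exact: weak_star_compact_separating_slice.
  + exact: convex_set_separating_slice.
  + move=> x _; exists 0; last by [].
    have p0 z : pairing z (0 : dual X) = 0 by [].
    by split => [z|]; rewrite ?/mkset p0 ?normr0 ?mul1r ?oppr0.
- by move=> K [_ _ /(_ c Cc)[y Ky _]]; exists y.
- apply/seteqP; split => [x Cx K [_ _]|x Kx]; first exact.
  apply: contrapT => nCx.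
  have [r r0 sep] := closed_cone_separating_slice C x cC coneC nCx.
  have [|y [_ yx]] := Kx (separating_slice x r).
    split; last exact: sep.
      exact: weak_star_compact_separating_slice.
    exact: convex_set_separating_slice.
  by move: yx => /= yx; lra.
Qed.

End Representation.

Theorem theorem3p14 (R : realType) (X : completeNormedModType R) (C : set X) :
  [<-> closed C /\ is_cone C;
       exists2 KK : set (set (dual X)),
         represented_by C KK & forall K, KK K -> weak_star_compact K;
       exists2 KK : set (set (dual X)),
         represented_by C KK &
         forall K, KK K ->
           weak_star_compact K /\ convex_set (K : set (convex_lmodType (dual X)))].
Proof.
have closed_cone : (exists2 KK : set (set (dual X)),
    represented_by C KK & forall K, KK K -> weak_star_compact K) ->
    closed C /\ is_cone C.
  move=> [KK [_ KK0 ->] cKK]; apply: closed_cone_represented_set => K KKK.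
  by split; [exact: KK0|exact: cKK].
tfae.
- move=> [cC coneC]; have [KK CKK KKc] := closed_cone_represented C cC coneC.
  by exists KK => // K /KKc[].
- by move=> /closed_cone[]; exact: closed_cone_represented.
- by move=> [KK CKK KKc]; apply: closed_cone; exists KK => // K /KKc[].
Qed.
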